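(* For every integer $d\geq 1$ and every boolean function $f:\{0,1\}^n\to\{0,1\}$ with $\deg(f)\le d$, \[ \sum_{i\in[n]} \frac{\delta_i(f)}{2^{\mathrm{cert}_i(f)}} \leq \frac{1}{2}. \]
   Context: For $x\in\{0,1\}^n$, $x^i$ is $x$ with bit $i$ flipped. $\delta_i(f)=1$ if there is $x$ with $f(x)\ne f(x^i)$ (i.e. $i$ is relevant) and $\delta_i(f)=0$ otherwise. $\deg(f)$ is the degree of the multilinear polynomial representing $f$. $C_x(f)$ is the smallest size of a set $S\subseteq[n]$ such that $f$ is constant on $\{y: y_j=x_j\ \forall j\in S\}$. $\mathrm{cert}_i(f):=\max_{x: f(x)\neq f(x^i)} \left(C_x(f)+C_{x^i}(f)\right)$, and $\mathrm{cert}_i(f):=0$ if $i$ is not relevant. *)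

(* Defs.v *)
From mathcomp Require Import all_boot all_order all_algebra.
From mathcomp.multinomials Require Import mpoly.

Set Implicit Arguments.
Unset Strict Implicit.
Unset Printing Implicit Defensive.

Import Order.TTheory GRing.Theory Num.Theory.
Local Open Scope ring_scope.

Notation cube n := {ffun 'I_n -> bool}.

Definition flip n (x : cube n) (i : 'I_n) : cube n :=
  [ffun j => if j == i then ~~ x j else x j].

Definition relevant n (f : cube n -> bool) (i : 'I_n) : bool :=
  [exists x : cube n, f x != f (flip x i)].

Definition delta n (f : cube n -> bool) (i : 'I_n) : nat :=
  if relevant f i then 1%N else 0%N.

Definition subcube n (x : cube n) (S : {set 'I_n}) : {set cube n} :=
  [set y : cube n | [forall j in S, y j == x j]].

Definition is_certificate n (f : cube n -> bool) (x : cube n)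
    (S : {set 'I_n}) : bool :=
  [forall y in subcube x S, forall z in subcube x S, f y == f z].

(* The default value setT is always a certificate: see [certificate_setT]. *)
Definition certificate_complexity n (f : cube n -> bool) (x : cube n) : nat :=
  #|[arg min_(S < setT | is_certificate f x S) #|S|]|.

(* An empty \max is 0, so this is 0 when i is not relevant. *)
Definition cert n (f : cube n -> bool) (i : 'I_n) : nat :=
  (\max_(x : cube n | f x != f (flip x i))
    (certificate_complexity f x + certificate_complexity f (flip x i)))%N.

Definition multilinear (R : realFieldType) n (p : {mpoly R[n]}) : Prop :=
  forall m : 'X_{1..n}, m \in msupp p -> forall i, (m i <= 1)%N.

Definition represents (R : realFieldType) n (p : {mpoly R[n]})
    (f : cube n -> bool) : Prop :=
  forall x : cube n, p.@[fun i => (x i)%:R] = (f x)%:R.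

(* Interpolation formula; [mlpolyP] and [mlpoly_unique] below show that this is
   the unique multilinear polynomial representing f. *)
Definition mlpoly (R : realFieldType) n (f : cube n -> bool) : {mpoly R[n]} :=
  \sum_(x : cube n | f x) \prod_(i < n) (if x i then 'X_i else 1 - 'X_i).

(* [msize] is the total degree plus one, and is 0 for the zero polynomial, to
   which this assigns degree 0. *)
Definition deg (R : realFieldType) n (f : cube n -> bool) : nat :=
  (msize (mlpoly R f)).-1.

Lemma certificate_setT n (f : cube n -> bool) (x : cube n) :
  is_certificate f x setT.
Proof.
have E y : y \in subcube x setT -> y = x.
  rewrite inE => /forall_inP h; apply/ffunP => j.
  by apply/eqP/h; rewrite in_setT.
by apply/forall_inP => y /E ->; apply/forall_inP => z /E ->.
Qed.

Lemma certificate_complexityP n (f : cube n -> bool) (x : cube n) :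
  (exists2 S, is_certificate f x S & certificate_complexity f x = #|S|) /\
  (forall S, is_certificate f x S -> (certificate_complexity f x <= #|S|)%N).
Proof.
rewrite /certificate_complexity; case: arg_minnP => [|S cS minS].
  exact: certificate_setT.
by split=> //; exists S.
Qed.

Lemma mlpoly_multilinear (R : realFieldType) n (f : cube n -> bool) :
  multilinear (mlpoly R f).
Proof.
move=> m + k; move/msupp_sum_le/flattenP => [s /mapP[x _ ->]].
have : forall m, m \in msupp (\prod_(i < n) (if x i then 'X_i else 1 - 'X_i)
    : {mpoly R[n]}) -> (m k <= \sum_(i < n) (i == k))%N.
  elim/big_rec2: _ => [m'|i e p _ IH m'].
    by rewrite msupp1 inE => /eqP ->; rewrite mnm0E.
  move/msuppM_le/allpairsP => [[m1 m2] [/= h1 h2 ->]].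
  rewrite mnmDE leq_add ?IH //.
  move: h1; case: (x i) => [|/msuppB_le].
    by rewrite msuppX inE => /eqP ->; rewrite mnm1E.
  rewrite mem_cat msuppX msupp1 !inE => /orP[] /eqP ->.
    by rewrite mnm0E.
  by rewrite mnm1E.
move=> H /H; rewrite (bigD1 k) //= eqxx big1 ?addn0 //.
by move=> i /negPf ->.
Qed.

Lemma mlpoly_represents (R : realFieldType) n (f : cube n -> bool) :
  represents (mlpoly R f) f.
Proof.
move=> x; rewrite /mlpoly raddf_sum /=.
have E (y : cube n) :
    (\prod_(i < n) (if y i then 'X_i else 1 - 'X_i) : {mpoly R[n]}).@[
      fun i => (x i)%:R] = (y == x)%:R.
  rewrite rmorph_prod /=; have [->|neq] := eqVneq y x.
    rewrite big1 // => i _; case e: (x i).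
      by rewrite mevalXU /= e.
    by rewrite mevalB meval1 mevalXU /= e subr0.
  have /existsP[i ni] : [exists i, y i != x i].
    apply: contraNT neq; rewrite negb_exists => /forallP h.
    by apply/eqP/ffunP => i; apply/eqP; rewrite -[_ == _]negbK.
  rewrite (bigD1 i) //=; move: ni; case ey: (y i); case ex: (x i) => // _.
    by rewrite mevalXU /= ex mul0r.
  by rewrite mevalB meval1 mevalXU /= ex subrr mul0r.
under eq_bigr do rewrite E.
case fx: (f x).
  rewrite (bigD1 x) //= eqxx big1 ?addr0 // => y /andP[_ /negPf ->] //.
by rewrite big1 // => y fy; case: eqP fy => // ->; rewrite fx.
Qed.

Lemma multilinear_cube0 (R : realFieldType) n (p : {mpoly R[n]}) :
  multilinear p -> (forall x : cube n, p.@[fun i => (x i)%:R] = 0) -> p = 0.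
Proof.
move=> ml p0; apply/eqP; rewrite -msupp_eq0; apply/eqP.
case e: (msupp p) => [|m0 s] //.
have m0p : m0 \in msupp p by rewrite e mem_head.
have [m mp minm] : exists2 m, m \in msupp p &
    forall m', m' \in msupp p -> (mdeg m <= mdeg m')%N.
  have exd : exists d, has (fun m => mdeg m == d) (msupp p).
    by exists (mdeg m0); apply/hasP; exists m0.
  case: (ex_minnP exd) => d /hasP[m mp /eqP <-] mind.
  by exists m => // m' m'p; apply: mind; apply/hasP; exists m'.
have := p0 [ffun i => m i == 1%N]; rewrite mevalE.
rewrite (bigD1_seq m) ?msupp_uniq //= [X in _ + X]big_seq_cond.
rewrite [X in _ + X]big1 => [|m' /andP[m'p ne]].
  rewrite addr0 big1 ?mulr1 => [/eqP|i _].
    by move: mp; rewrite mcoeff_msupp => /negPf ->.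
  by rewrite ffunE; case: (m i) (ml _ mp i) => [|[|k]] //= _; rewrite expr1.
suff /existsP[i /andP[mi m'i]] : [exists i, (m i == 0%N) && (m' i == 1%N)].
  by rewrite (bigD1 i) //= ffunE (eqP mi) (eqP m'i) /= expr1 mul0r mulr0.
apply: contraNT ne; rewrite negb_exists => /forallP h.
have le i : (m' i <= m i)%N.
  by move: (h i) (ml _ mp i) (ml _ m'p i); case: (m i) (m' i) => [|[|?]] [|[|?]].
have := minm _ m'p; rewrite !mdegE => hle.
have /leqif_sum [_] : forall i : 'I_n, true -> (m' i <= m i ?= iff (m' i == m i))%N.
  by move=> i _; split.
rewrite eqn_leq hle leq_sum //= => /esym /forallP eqm.
by apply/eqP/mnmP => i; apply/eqP/(implyP (eqm i)).
Qed.

Lemma mlpolyP (R : realFieldType) n (f : cube n -> bool) :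
  multilinear (mlpoly R f) /\ represents (mlpoly R f) f.
Proof. by split; [exact: mlpoly_multilinear | exact: mlpoly_represents]. Qed.

Lemma mlpoly_unique (R : realFieldType) n (f : cube n -> bool)
    (p : {mpoly R[n]}) :
  multilinear p -> represents p f -> p = mlpoly R f.
Proof.
move=> mlp rp; apply/eqP; rewrite -subr_eq0; apply/eqP.
apply: multilinear_cube0 => [m /msuppB_le|x].
  by rewrite mem_cat => /orP[/mlp|/mlpoly_multilinear].
by rewrite mevalB rp mlpoly_represents subrr.
Qed.

(* Main.v *)
Require Import Defs.
From mathcomp Require Import all_boot all_order all_algebra.
From mathcomp Require Import zify.

(** Induct on the number of relevant variables.  Let [S] be a certificate of
    [f] at [x] whose size [k] is minimal among all certificates of [f] at all
    points.
    - For [i] in [S] some edge in direction [i] is sensitive, and both of its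
      ends have certificate complexity at least [k]; hence these variables
      contribute at most [k / 2^(2k) <= (1/2) / 2^k].
    - For [i] outside [S], the weight [2^-cert_i] of [f] is at most its average
      over all restrictions of the variables in [S]: among the sensitive edges
      in direction [i], let [o] be the least total overlap with [S] of minimum
      certificates of the two ends.  The variable [i] stays relevant for a
      fraction at least [2^-o] of the restrictions, and whenever it does,
      [cert_i] has dropped by at least [o].
    The restrictions agreeing with [x] on [S], a fraction [2^-k], make [f]
    constant, so by induction the second part contributes at most
    [(1/2) (1 - 2^-k)]. *)

Set Implicit Arguments.
Unset Strict Implicit.
Unset Printing Implicit Defensive.

Import Order.TTheory GRing.Theory Num.Theory.
Local Open Scope ring_scope.

(** * Minimum certificates and the subcubes they fix *)

Definition min_certificate n (f : cube n -> bool) (x : cube n) : {set 'I_n} :=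
  [arg min_(S < setT | is_certificate f x S) #|S|].

Lemma min_certificateP n (f : cube n -> bool) x :
  is_certificate f x (min_certificate f x).
Proof.
by rewrite /min_certificate; case: arg_minnP => //; exact: certificate_setT.
Qed.

Lemma certificate_complexity_le n (f : cube n -> bool) x S :
  is_certificate f x S -> (certificate_complexity f x <= #|S|)%N.
Proof. by case: (certificate_complexityP f x) => _; apply. Qed.

Lemma subcubeP n (x y : cube n) (S : {set 'I_n}) :
  reflect {in S, forall j, y j = x j} (y \in subcube x S).
Proof.
rewrite inE; apply: (iffP forall_inP) => h j jS; first exact/eqP/h.
exact/eqP/h.
Qed.

Lemma subcube_refl n (x : cube n) S : x \in subcube x S.
Proof. exact/subcubeP. Qed.

Lemma is_certificateP n (f : cube n -> bool) x S :
  reflect {in subcube x S, forall y, f y = f x} (is_certificate f x S).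
Proof.
apply: (iffP forall_inP) => [h y yS | h y yS].
  by have /forall_inP/(_ _ (subcube_refl x S))/eqP := h y yS.
by apply/forall_inP => z zS; rewrite !h.
Qed.

Lemma card_subcube n (x : cube n) (S : {set 'I_n}) :
  #|subcube x S| = (2 ^ (n - #|S|))%N.
Proof.
pose F j : pred bool := [pred b | (j \in S) ==> (b == x j)].
have -> : #|subcube x S| = #|family F|.
  by apply: eq_card => y; rewrite inE.
rewrite card_family foldrE big_map big_enum /=.
rewrite (eq_bigr (fun j : 'I_n => if j \in ~: S then 2 else 1)%N); last first.
  move=> j _; rewrite inE; case: ifPn => [/negPf jS | /negPn jS].
    by rewrite -card_bool; apply: eq_card => b; rewrite !inE /= jS.
  by rewrite -(card1 (x j)); apply: eq_card => b; rewrite !inE /= jS.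
by rewrite -big_mkcond prod_nat_const cardsCs setCK card_ord.
Qed.

Lemma cert_ge n (f : cube n -> bool) i y : f y != f (flip y i) ->
  (certificate_complexity f y + certificate_complexity f (flip y i)
     <= cert f i)%N.
Proof.
move=> sy; rewrite /cert.
exact: (@leq_bigmax_cond _ _ (fun x => certificate_complexity f x +
  certificate_complexity f (flip x i))%N).
Qed.

(** * Fixing the variables in a set *)

Definition mix n (S : {set 'I_n}) (r y : cube n) : cube n :=
  [ffun j => if j \in S then r j else y j].

Definition restriction n (S : {set 'I_n}) (r : cube n) (f : cube n -> bool) :
  cube n -> bool := fun y => f (mix S r y).

Lemma mix_flip n (S : {set 'I_n}) r y i : i \notin S ->
  mix S r (flip y i) = flip (mix S r y) i.
Proof.
move=> iS; apply/ffunP => j; rewrite !ffunE.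
by have [->|//] := eqVneq j i; rewrite (negPf iS).
Qed.

Lemma mix_flip_in n (S : {set 'I_n}) r y i : i \in S ->
  mix S r (flip y i) = mix S r y.
Proof.
move=> iS; apply/ffunP => j; rewrite !ffunE.
by have [->|//] := eqVneq j i; rewrite iS.
Qed.

Lemma relevant_restriction n (S : {set 'I_n}) r (f : cube n -> bool) i :
  relevant (restriction S r f) i -> relevant f i && (i \notin S).
Proof.
move=> /existsP[y]; rewrite /restriction.
have [iS|iS] := boolP (i \in S); first by rewrite mix_flip_in ?eqxx.
by rewrite mix_flip // andbT => sy; apply/existsP; exists (mix S r y).
Qed.

(** A certificate at [mix S r y] with its part in [S] removed still certifies the restriction at
    [y], because [mix] already fixes that part. *)
Lemma certificate_complexity_restriction n (S : {set 'I_n}) r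
    (f : cube n -> bool) y :
  (certificate_complexity (restriction S r f) y
     + #|min_certificate f (mix S r y) :&: S|
   <= certificate_complexity f (mix S r y))%N.
Proof.
set A := min_certificate _ _; rewrite {2}/certificate_complexity -/A.
rewrite -(cardsID S A) addnC leq_add2l; apply: certificate_complexity_le.
apply/is_certificateP => z /subcubeP hz.
apply: (is_certificateP _ _ _ (min_certificateP f (mix S r y))).
apply/subcubeP => j jA; rewrite !ffunE; case: ifPn => // jS.
by apply: hz; rewrite inE jS.
Qed.

Definition cert_overlap n (f : cube n -> bool) (i : 'I_n) (S : {set 'I_n})
    (y : cube n) : nat :=
  (#|min_certificate f y :&: S| + #|min_certificate f (flip y i) :&: S|)%N.

(** Take an edge attaining [cert] of the restriction. Its image under [mix S r] is sensitive for
    [f], and each end saves its own overlap with [S]. *)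
Lemma cert_restriction n (S : {set 'I_n}) r (f : cube n -> bool) i o :
    i \notin S -> relevant (restriction S r f) i ->
    (forall y, f y != f (flip y i) -> (o <= cert_overlap f i S y)%N) ->
  (cert (restriction S r f) i + o <= cert f i)%N.
Proof.
move=> iS /existsP[y0 sy0] ole.
have [y sy ->] : {y | restriction S r f y != restriction S r f (flip y i) &
    cert (restriction S r f) i =
    (certificate_complexity (restriction S r f) y +
     certificate_complexity (restriction S r f) (flip y i))%N}.
  by apply: eq_bigmax_cond; apply/card_gt0P; exists y0.
have sy' : f (mix S r y) != f (flip (mix S r y) i) by rewrite -mix_flip.
apply: leq_trans (cert_ge sy'); have := ole _ sy'; rewrite /cert_overlap.
have := certificate_complexity_restriction S r f y.
have := certificate_complexity_restriction S r f (flip y i).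
rewrite mix_flip //; lia.
Qed.

(** Such an [r] overwrites neither end of the edge on its minimum certificate, so both values of [f]
    survive. As [i] is not in [S], the two ends agree on [S] and one [r] serves both. *)
Lemma relevant_restriction_subcube n (S : {set 'I_n}) r (f : cube n -> bool)
    i y : i \notin S -> f y != f (flip y i) ->
    r \in subcube y
      ((min_certificate f y :|: min_certificate f (flip y i)) :&: S) ->
  relevant (restriction S r f) i.
Proof.
move=> iS sy /subcubeP hr; apply/existsP; exists y; rewrite /restriction.
have -> : f (mix S r y) = f y.
  apply: (is_certificateP _ _ _ (min_certificateP f y)).
  apply/subcubeP => j jA; rewrite ffunE; case: ifPn => // jS.
  by apply: hr; rewrite !inE jA jS.
suff -> : f (mix S r (flip y i)) = f (flip y i) by [].
apply: (is_certificateP _ _ _ (min_certificateP f (flip y i))).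
apply/subcubeP => j jB; rewrite ffunE; case: ifPn => // jS.
rewrite hr ?inE ?jB ?jS ?orbT // ffunE.
by case: eqP jS iS => // -> ->.
Qed.

(** * Weights and their averages over restrictions *)

Definition weight (R : realFieldType) n (f : cube n -> bool) (i : 'I_n) : R :=
  (delta f i)%:R / 2%:R ^+ cert f i.

Lemma weight_ge0 (R : realFieldType) n (f : cube n -> bool) i :
  0 <= weight R f i.
Proof. by rewrite /weight divr_ge0 ?exprn_ge0. Qed.

Lemma weight_irrelevant (R : realFieldType) n (f : cube n -> bool) i :
  ~~ relevant f i -> weight R f i = 0.
Proof. by rewrite /weight /delta => /negPf ->; rewrite mul0r. Qed.

Lemma weight_le (R : realFieldType) n (f : cube n -> bool) i m :
  (m <= cert f i)%N -> weight R f i <= 2%:R ^- m.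
Proof.
move=> mle; rewrite /weight /delta; case: ifP => _; last first.
  by rewrite mul0r invr_ge0 exprn_ge0.
rewrite mul1r lef_pV2 ?posrE ?exprn_gt0 ?ltr0n //.
by rewrite ler_weXn2l ?ler1n.
Qed.

Lemma weight_le_restriction (R : realFieldType) n (f : cube n -> bool)
    (S : {set 'I_n}) i : i \notin S ->
  2%:R ^+ n * weight R f i <= \sum_(r : cube n) weight R (restriction S r f) i.
Proof.
move=> iS; have [/existsP[y0 sy0]|irr] := boolP (relevant f i); last first.
  by rewrite weight_irrelevant // mulr0 sumr_ge0 // => r _; exact: weight_ge0.
pose y := [arg min_(y < y0 | f y != f (flip y i)) cert_overlap f i S y].
have [sy ymin] : f y != f (flip y i) /\ forall z, f z != f (flip z i) ->
    (cert_overlap f i S y <= cert_overlap f i S z)%N.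
  by rewrite /y; case: arg_minnP.
set o := cert_overlap f i S y in ymin.
pose D := (min_certificate f y :|: min_certificate f (flip y i)) :&: S.
have Do : (#|D| <= o)%N.
  by rewrite /D setIUl (leq_trans (leq_card_setU _ _)).
have Dn : (#|D| <= n)%N by rewrite -[n in leqRHS]card_ord max_card.
have rel r : r \in subcube y D -> relevant (restriction S r f) i.
  exact: relevant_restriction_subcube.
(* This makes the truncated subtraction [cert f i - o] below exact. *)
have ocert : (o <= cert f i)%N.
  have := cert_restriction iS (rel _ (subcube_refl y D)) ymin; lia.
apply: (@le_trans _ _ (\sum_(r in subcube y D) 2%:R ^- (cert f i - o))).
  rewrite sumr_const card_subcube -[leRHS]mulr_natl natrX /weight /delta.
  have -> : relevant f i by apply/existsP; exists y0.
  rewrite mul1r ler_pdivrMr ?exprn_gt0 ?ltr0n // mulrAC.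
  rewrite ler_pdivlMr ?exprn_gt0 ?ltr0n // -!exprD.
  rewrite ler_weXn2l ?ler1n //; lia.
rewrite [leRHS](bigID (mem (subcube y D))) /= -[leLHS]addr0.
apply: lerD; last by apply: sumr_ge0 => r _; exact: weight_ge0.
apply: ler_sum => r rD; rewrite /weight /delta rel // mul1r.
rewrite lef_pV2 ?posrE ?exprn_gt0 ?ltr0n // ler_weXn2l ?ler1n //.
have := cert_restriction iS (rel _ rD) ymin; lia.
Qed.

(** By minimality, dropping [i] loses the certificate: some [y] agrees with [x] on the rest of [S]
    but has another value. It must differ from [x] at [i], so flipping [i] returns it to the subcube
    of [x]. *)
Lemma min_certificate_sensitive n (f : cube n -> bool) x i :
    i \in min_certificate f x ->
  exists y, f y != f (flip y i).
Proof.
set S := min_certificate f x => iS.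
have cS : is_certificate f x S by exact: min_certificateP.
have ncS : ~~ is_certificate f x (S :\ i).
  apply/negP => /certificate_complexity_le.
  by rewrite /certificate_complexity -/(min_certificate f x) -/S (cardsD1 i S)
             iS ltnn.
have [y yS fy] : exists2 y, y \in subcube x (S :\ i) & f y != f x.
  apply/exists_inP; apply: contraNT ncS; rewrite negb_exists_in => /forall_inP h.
  by apply/is_certificateP => z /h; rewrite negbK => /eqP.
exists y; suff -> : f (flip y i) = f x by [].
apply: (is_certificateP _ _ _ cS); apply/subcubeP => j jS; rewrite ffunE.
have yx k : k \in S -> k != i -> y k = x k.
  by move=> kS ki; apply: (subcubeP _ _ _ yS); rewrite !inE ki.
case: eqVneq => [->|ji]; last exact: yx.
have : y i != x i.
  apply: contraNneq fy => yxi; apply/eqP/(is_certificateP _ _ _ cS).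
  apply/subcubeP => k kS; have [->//|ki] := eqVneq k i; exact: yx.
by case: (y i); case: (x i).
Qed.

Lemma restriction_certificate n (f : cube n -> bool) x S r i :
    is_certificate f x S -> r \in subcube x S ->
  ~~ relevant (restriction S r f) i.
Proof.
move=> /is_certificateP cS /subcubeP rS.
have E y : restriction S r f y = f x.
  apply: cS; apply/subcubeP => j jS; rewrite ffunE jS; exact: rS.
by apply/existsPn => y; rewrite !E eqxx.
Qed.

(** * The induction *)

Lemma sum_weight_le (R : realFieldType) n (f : cube n -> bool) :
  \sum_(i < n) weight R f i <= 1 / 2%:R.
Proof.
have [m] := ubnP #|[set i | relevant f i]|.
elim: m f => // m IH f; rewrite ltnS => fm.
have [/existsP[i0 ri0]|irr] := boolP [exists i, relevant f i]; last first.
  rewrite big1 ?divr_ge0 // => i _; apply: weight_irrelevant.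
  by move/existsPn: irr; apply.
have /existsP[x0 sx0] := ri0.
pose x := [arg min_(x < x0) certificate_complexity f x].
have xmin y : (certificate_complexity f x <= certificate_complexity f y)%N.
  by rewrite /x; case: arg_minnP => // z _; apply.
set S := min_certificate f x.
have cS : is_certificate f x S by exact: min_certificateP.
set k := #|S|.
have kE : certificate_complexity f x = k by [].
have kn : (k <= n)%N by rewrite -[n in leqRHS]card_ord max_card.
(* An empty certificate would make [f] constant, against the sensitive edge at [x0]. *)
have k_gt0 : (0 < k)%N.
  rewrite lt0n cards_eq0; apply: contraNneq sx0 => S0; rewrite -/S in S0.
  by apply/eqP; rewrite !(is_certificateP _ _ _ cS) //;
     apply/subcubeP => j; rewrite S0 inE.
have Srel i : i \in S -> relevant f i.
  by move=> /min_certificate_sensitive[y sy]; apply/existsP; exists y.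
have Sin : \sum_(i in S) weight R f i <= 1 / 2%:R / 2%:R ^+ k.
  apply: (@le_trans _ _ (\sum_(i in S) 2%:R ^- (k + k))).
    apply: ler_sum => i /min_certificate_sensitive[y sy]; apply: weight_le.
    by apply: leq_trans (cert_ge sy); rewrite leq_add -?kE ?xmin.
  rewrite sumr_const -/k -[leLHS]mulr_natl exprD invfM mulrA.
  rewrite ler_pM2r ?invr_gt0 ?exprn_gt0 ?ltr0n //.
  (* What remains is [k <= 2 ^ k.-1], which is [ltn_expl] at [k.-1]. *)
  rewrite ler_pdivrMr ?exprn_gt0 ?ltr0n // mul1r -(prednK k_gt0) exprS.
  rewrite mulKf ?pnatr_eq0 // -natrX ler_nat; exact: ltn_expl.
have Sout : 2%:R ^+ n * \sum_(i | i \notin S) weight R f i <=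
    (2%:R ^+ n - 2%:R ^+ (n - k)) * (1 / 2%:R).
  rewrite mulr_sumr (le_trans (ler_sum _ (fun i => @weight_le_restriction _ _ _ _ i))) //.
  rewrite exchange_big /= (bigID (mem (subcube x S))) /= big1 ?add0r; last first.
    move=> r rS; rewrite big1 // => i _; apply: weight_irrelevant.
    exact: restriction_certificate cS rS.
  apply: (@le_trans _ _ (\sum_(r | r \notin subcube x S) 1 / 2%:R)).
    apply: ler_sum => r _; apply: (@le_trans _ _ (\sum_i weight R (restriction S r f) i)).
      rewrite [leRHS](bigID (mem S)) /= lerDr sumr_ge0 // => i _.
      exact: weight_ge0.
    (* The count of relevant variables drops strictly: [S] is nonempty, its variables are relevant
       to [f], and restricting kills them. *)
    apply: IH; apply: leq_trans fm; apply: proper_card.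
    apply/properP; split.
      apply/subsetP => i; rewrite !inE => /relevant_restriction.
      by case/andP.
    move: k_gt0; rewrite card_gt0 => /set0Pn[i iS].
    exists i; rewrite inE ?Srel //.
    by apply/negP => /relevant_restriction; rewrite iS andbF.
  rewrite sumr_const -[leLHS]mulr_natl; set N := #|_|.
  suff -> : N = (2 ^ n - 2 ^ (n - k))%N.
    by rewrite natrB ?leq_exp2l ?leq_subr // !natrX.
  have := cardC (mem (subcube x S)).
  rewrite card_ffun card_bool card_ord card_subcube -/k => <-.
  by rewrite addKn; apply: eq_card.
(* After scaling by [2 ^ n], the terms [2 ^ (n - k) / 2] of the two bounds cancel, leaving exactly
   [2 ^ n / 2]. *)
rewrite (bigID (mem S)) /=.
have p2 m' : 0 < 2%:R ^+ m' :> R by rewrite exprn_gt0 ?ltr0n.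
rewrite -(ler_pM2l (p2 n)) mulrDr.
apply: le_trans (lerD (ler_wpM2l (ltW (p2 n)) Sin) Sout) _.
have -> : 2%:R ^+ n * (1 / 2%:R / 2%:R ^+ k) = 2%:R ^+ (n - k) * (1 / 2%:R) :> R.
  by rewrite mulrA -[n in LHS](subnK kn) exprD [X in X / _]mulrAC mulfK ?gt_eqF.
by rewrite -mulrDl addrC subrK.
Qed.

Theorem theorem4 (R : realFieldType) (d n : nat) (f : cube n -> bool) :
  (1 <= d)%N -> (deg R f <= d)%N ->
  \sum_(i < n) (delta f i)%:R / 2%:R ^+ cert f i <= 1 / 2%:R :> R.
Proof. by move=> _ _; exact: sum_weight_le. Qed.
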